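(* Let $X$ be a real vector space with norm $\|\cdot\|$, $\mathcal{D}\subset X$ a nonempty convex set whose linear span is $X$, and $\mathcal{V}$ the topological dual of $(X,\|\cdot\|)$, with evaluation pairing $\langle v,x\rangle$ and dual norm $\|\cdot\|'$. Let $F:\mathcal{D}\to\mathbb{R}$ be convex and bounded below, such that $F$, extended to the completion of $(X,\|\cdot\|)$ by the value $+\infty$ off $\mathcal{D}$, is lower semicontinuous. For $v\in\mathcal{V}$ let $E(v)=\inf\{F(\rho)+\langle v,\rho\rangle:\rho\in\mathcal{D}\}$ and assume $E(v)>-\infty$ for every $v\in\mathcal{V}$. Let $\Delta(v,\rho)=F(\rho)+\langle v,\rho\rangle-E(v)$ on $\mathcal{V}\times\mathcal{D}$ and $\mathcal{Z}=\{\Delta=0\}$. Equip $\mathcal{V}\times\mathcal{D}$ with the metric $(d'+d)((v,\rho),(v',\rho'))=\|v-v'\|'+\|\rho-\rho'\|$, and regard $E$ and $F$ as functions $(v,\rho)\mapsto E(v)$, $(v,\rho)\mapsto F(\rho)$ on this metric space. Then: 1. for every $\epsilon<\infty$, the metric subspace $\{\Delta\le\epsilon\}$ is complete; 2. $E$ is locally Lipschitz continuous; 3. the restriction of $F$ to $\mathcal{Z}$ is locally Lipschitz continuous; 4. $F$ is $\Delta$-almost continuous.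
   Context: A real function $f$ on a metric space $(S,d_S)$ is locally Lipschitz continuous if every point of $S$ has a neighborhood $U$ and a constant $K>0$ such that $|f(y)-f(z)|\le K\,d_S(y,z)$ for all $y,z\in U$. For $\epsilon\geq 0$, $f:S\to\mathbb{R}$ is $\epsilon$-almost continuous at $x$ if for every $\epsilon'>0$ there is $\delta>0$ such that $d_S(y,x)<\delta$ implies $|f(x)-f(y)|<\epsilon+\epsilon'$; it is $\epsilon$-almost continuous on $S$ if this holds at every $x\in S$. For $g:S\to[0,\infty)$, $f$ is $g$-almost continuous if for every $\epsilon>0$ the restriction of $f$ to the metric subspace $\{g\le\epsilon\}$ is $\epsilon$-almost continuous. *)

(* Defs.v *)
From HB Require Import structures.
From mathcomp Require Import all_boot all_order all_algebra.
From mathcomp Require Import all_classical all_reals all_analysis.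
Set Implicit Arguments.
Unset Strict Implicit.
Unset Printing Implicit Defensive.
Import Order.TTheory GRing.Theory Num.Def Num.Theory.
Import numFieldNormedType.Exports.
Local Open Scope classical_set_scope.
Local Open Scope ring_scope.

(* A subset [A : set S], used as a type, already has the pseudometric induced
   by [S]; the induced distance makes it a metric space. *)
Section metric_subspace.
Context {R : realType} {S : metricType R} (A : set S).

Let sdist (x y : A) : R := mdist (\val x : S) (\val y).

Let sdist_ge0 x y : 0 <= sdist x y.
Proof. exact: mdist_ge0. Qed.

Let sdist_positivity x y : sdist x y = 0 -> x = y.
Proof. by move=> /mdist_positivity; exact: val_inj. Qed.

Let ballEsdist (x : A) d : ball x d = [set y | sdist x y < d].
Proof.
have -> : ball x d = \val @^-1` ball (\val x : S) d by [].
by rewrite ballEmdist.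
Qed.

HB.instance Definition _ := @PseudoMetric_isMetric.Build R (A : Type)
  sdist sdist_ge0 sdist_positivity ballEsdist.

End metric_subspace.

(* The library's notion of completeness (see [cauchy_cvg]), without its
   restriction to pointed spaces: a metric subspace may be empty. *)
Definition complete_space (T : uniformType) :=
  forall G : set_system T, ProperFilter G -> cauchy G -> exists l : T, G --> l.

Section functions_on_metric_spaces.
Context {R : realType} {S : metricType R}.
Implicit Types (f g : S -> R) (x y z : S) (eps : R).

Definition locally_lipschitz f := forall x,
  exists2 U : set S, nbhs x U & exists2 K : R, 0 < K &
    forall y z, U y -> U z -> `|f y - f z| <= K * mdist y z.

Definition almost_continuous_at eps f x := forall eps', 0 < eps' ->
  exists2 delta : R, 0 < delta &
    forall y, mdist y x < delta -> `|f x - f y| < eps + eps'.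

Definition almost_continuous eps f := forall x, almost_continuous_at eps f x.

End functions_on_metric_spaces.

(* [g]-almost continuity, for a nonnegative [g] *)
Definition almost_continuous_wrt {R : realType} {S : metricType R}
    (g f : S -> R) :=
  forall eps : R, 0 < eps ->
    almost_continuous eps (fun p : [set x | g x <= eps] => f (\val p)).

Definition linear_span {R : realType} {X : lmodType R} (A : set X) : set X :=
  [set x | exists n (c : 'I_n -> R) (a : 'I_n -> X),
    (forall k, A (a k)) /\ x = \sum_(k < n) c k *: a k].

(* [i] exhibits [Y] as the completion of [X], which is determined up to a unique
   isometric isomorphism. *)
Definition is_completion {R : realType} {X : normedModType R}
    {Y : completeNormedModType R} (i : {linear X -> Y}) :=
  (forall x, `|i x| = `|x|) /\ dense (range i).

(* [F], restricted to [D] and viewed on [Y] through the injection [i],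
   extended by +oo off the image of [D]. *)
Definition extend_pinfty {R : realType} {X Y : normedModType R} (i : X -> Y)
    (D : set X) (F : X -> R) : Y -> \bar R :=
  patch (cst +oo%E) (i @` D) (fun y => (F ('pinv_(fun=> 0) D i y))%:E).

Lemma extend_pinfty_in {R : realType} {X Y : normedModType R} (i : X -> Y)
    (D : set X) (F : X -> R) : injective i ->
  forall x, D x -> extend_pinfty i D F (i x) = (F x)%:E.
Proof.
move=> inj_i x Dx; rewrite /extend_pinfty patchT; last first.
  by rewrite inE; exists x.
by rewrite pinvKV ?inE// => a b _ _; exact: inj_i.
Qed.

Lemma extend_pinfty_notin {R : realType} {X Y : normedModType R} (i : X -> Y)
    (D : set X) (F : X -> R) y :
  ~ (i @` D) y -> extend_pinfty i D F y = +oo%E.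
Proof. by move=> Dy; rewrite /extend_pinfty patchN// notin_setE. Qed.

Section topological_dual.
Context {R : realType} (X : normedModType R).

Record dual := Dual {
  dual_fun :> {linear X -> R^o} ;
  dual_continuous : continuous dual_fun }.

HB.instance Definition _ := gen_eqMixin dual.
HB.instance Definition _ := gen_choiceMixin dual.

Definition dual_norm (v : X -> R) : R :=
  sup [set `|v x| | x in [set x | `|x| <= 1]].

Definition dual_dist (v w : dual) : R := dual_norm (fun x => v x - w x).

End topological_dual.

Section dual_dist_lemmas.
Context {R : realType} {X : normedModType R}.
Implicit Types u v w : dual X.

Lemma dual_ext v w : (forall x, v x = w x) -> v = w.
Proof.
case: v w => [v cv] [w cw] /= vw.
have {}vw : v = w :> {linear X -> R^o}.
  have : (v : X -> R^o) = w by apply/funext.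
  move: v w {cv cw vw} => [v [[a] [b]]] [w [[c] [d]]] /= vw.
  subst w; congr (GRing.Linear.Pack (GRing.Linear.Class _ _)).
    by congr GRing.isNmodMorphism.Axioms_; exact: Prop_irrelevance.
  by congr GRing.isScalable.Axioms_; exact: Prop_irrelevance.
subst w; congr Dual; exact: Prop_irrelevance.
Qed.

Lemma dual_diff_bounded v w :
  has_ubound [set `|v x - w x| | x in [set x : X | `|x| <= 1]].
Proof.
have bnd u : exists M, forall x : X, `|x| <= 1 -> `|u x| <= M.
  have /bounded_funP/(_ 1) := (linear_bounded_continuous u).2 (@dual_continuous _ _ u).
  by [].
have [M vM] := bnd v; have [N wN] := bnd w.
exists (M + N) => _ [x /= x1 <-].
by rewrite (le_trans (ler_normB _ _))// lerD ?vM ?wN.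
Qed.

Lemma dual_dist_ub v w (x : X) : `|x| <= 1 -> `|v x - w x| <= dual_dist v w.
Proof. by move=> x1; apply: ub_le_sup; [exact: dual_diff_bounded|exists x]. Qed.

Lemma dual_dist_le v w (M : R) :
  (forall x : X, `|x| <= 1 -> `|v x - w x| <= M) -> dual_dist v w <= M.
Proof.
move=> vwM; apply: ge_sup; last by move=> _ [x /= x1 <-]; exact: vwM.
by exists `|v 0 - w 0|; exists 0 => //=; rewrite normr0.
Qed.

Lemma dual_dist_ge0 v w : 0 <= dual_dist v w.
Proof.
by apply: le_trans (dual_dist_ub v w (x := 0) _); rewrite ?normr_ge0 ?normr0.
Qed.

Lemma dual_distxx v : dual_dist v v = 0.
Proof.
apply/eqP; rewrite eq_le dual_dist_ge0 andbT; apply: dual_dist_le => x _.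
by rewrite subrr normr0.
Qed.

Lemma dual_dist_sym v w : dual_dist v w = dual_dist w v.
Proof.
apply/eqP; rewrite eq_le; apply/andP.
by split; apply: dual_dist_le => x x1; rewrite distrC dual_dist_ub.
Qed.

Lemma dual_dist_triangle u v w :
  dual_dist v w <= dual_dist v u + dual_dist u w.
Proof.
apply: dual_dist_le => x x1.
by rewrite (le_trans (ler_distD (u x) _ _))// lerD ?dual_dist_ub.
Qed.

Lemma dual_dist_eq0 v w : dual_dist v w = 0 -> v = w.
Proof.
move=> vw0; apply: dual_ext => x; have [->|x0] := eqVneq x 0.
  by rewrite !linear0.
have nx0 : `|x| != 0 by rewrite normr_eq0.
have : `|v (`|x|^-1 *: x) - w (`|x|^-1 *: x)| <= 0.
  by rewrite -vw0 dual_dist_ub// normrZ normfV normr_id mulVf.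
have -> : v (`|x|^-1 *: x) - w (`|x|^-1 *: x) = `|x|^-1 * (v x - w x).
  by rewrite mulrBr; congr (_ - _); exact: linearZ.
by rewrite normr_le0 mulf_eq0 invr_eq0 (negbTE nx0)/= subr_eq0 => /eqP.
Qed.

End dual_dist_lemmas.

(* A copy of the product type [dual X * D], so that it does not carry the sup
   metric that the library puts on products. *)
Definition dual_pair {R : realType} {X : normedModType R} (D : set X) : Type :=
  (dual X * D)%type.

Section dual_pair_metric.
Context {R : realType} {X : normedModType R} (D : set X).
Implicit Types p q r : dual_pair D.

Definition dual_pair_dist p q : R :=
  dual_dist p.1 q.1 + `|\val p.2 - \val q.2|.

Let distxx p : dual_pair_dist p p = 0.
Proof. by rewrite /dual_pair_dist dual_distxx subrr normr0 addr0. Qed.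

Let dist_positivity p q : dual_pair_dist p q = 0 -> p = q.
Proof.
move=> /eqP; rewrite paddr_eq0 ?dual_dist_ge0// => /andP[/eqP/dual_dist_eq0].
rewrite normr_eq0 subr_eq0 => pq1 /eqP/val_inj pq2.
by case: p q pq1 pq2 => ? ? [? ?] /= -> ->.
Qed.

Let dist_sym p q : dual_pair_dist p q = dual_pair_dist q p.
Proof. by rewrite /dual_pair_dist dual_dist_sym distrC. Qed.

Let dist_triangle q p r :
  dual_pair_dist p r <= dual_pair_dist p q + dual_pair_dist q r.
Proof. by rewrite /dual_pair_dist addrACA lerD ?dual_dist_triangle ?ler_distD. Qed.

HB.instance Definition _ := Choice.copy (dual_pair D) (dual X * D)%type.
HB.instance Definition _ := @isMetric.Build R (dual_pair D)
  dual_pair_dist distxx dist_positivity dist_sym dist_triangle.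

End dual_pair_metric.

(* A function on [D] is represented by a function on [X] whose values off [D]
   are never used. *)
Section energies.
Context {R : realType} {X : normedModType R} (D : set X) (F : X -> R).

Definition energy (v : dual X) : \bar R :=
  ereal_inf [set (F rho + v rho)%:E | rho in D].

(* [fine] maps infinite values to 0; it is the identity here whenever [D] is
   nonempty and [energy v] is not -oo. *)
Definition E_fun (p : dual_pair D) : R := fine (energy p.1).

Definition F_fun (p : dual_pair D) : R := F (\val p.2).

Definition Delta (p : dual_pair D) : R :=
  F (\val p.2) + p.1 (\val p.2) - fine (energy p.1).

End energies.

(* Main.v *)
Require Import Defs.
From HB Require Import structures.
From mathcomp Require Import all_boot all_order all_algebra.
From mathcomp Require Import all_classical all_reals all_analysis.
From mathcomp Require Import ring lra.
Set Implicit Arguments.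
Unset Strict Implicit.
Unset Printing Implicit Defensive.
Import Order.TTheory GRing.Theory Num.Def Num.Theory.
Import numFieldNormedType.Exports.
Local Open Scope classical_set_scope.
Local Open Scope ring_scope.

(* The points of [D], divided by [F + v - E v + 1], form a weakly bounded set,
   because [E] is finite in every direction of the dual; by the uniform
   boundedness principle they are norm bounded. Hence almost minimizers stay
   bounded locally uniformly in [v], and [E] is locally Lipschitz. The function
   [H (v, rho) = E v - v rho] is then locally Lipschitz too, and [F = Delta + H]
   yields statements 3 and 4. For completeness, the limit of a Cauchy filter is
   taken in the dual and in the completion of [X]; lower semicontinuity forces
   its second component into [D] and [Delta] below [eps]. *)

(** * Bounded linear functionals and the Hahn-Banach theorem *)

Lemma dual_of_bounded_linear (R : realType) (X : normedModType R) (f : X -> R)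
    (M : R) :
  (forall c x y, f (c *: x + y) = c * f x + f y) ->
  (forall x, `|f x| <= M * `|x|) ->
  exists v : dual X, forall x, v x = f x.
Proof.
move=> f_lin f_bnd.
pose lin := GRing.isLinear.Build R X R^o *:%R f f_lin.
pose g : {linear X -> R^o} := HB.pack f lin.
suff g_cont : continuous g by exists (Dual g_cont).
apply/bounded_linear_continuous/bounded_funP => r.
exists (`|M| * r) => x xr; apply: le_trans (f_bnd x) _.
by rewrite (le_trans (ler_wpM2r _ (ler_norm M)))// ler_wpM2l.
Qed.

Lemma dual_dist_bound (R : realType) (X : normedModType R) (v w : dual X)
    (x : X) :
  `|v x - w x| <= dual_dist v w * `|x|.
Proof.
have [->|x0] := eqVneq x 0.
  by rewrite (linear0 v) (linear0 w) subr0 !normr0 mulr0.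
have nx_gt0 : 0 < `|x| by rewrite normr_gt0.
have := @dual_dist_ub _ _ v w (`|x|^-1 *: x).
rewrite normrZ normfV normr_id mulVf ?gt_eqF// => /(_ (lexx _)).
have -> : v (`|x|^-1 *: x) - w (`|x|^-1 *: x) = `|x|^-1 * (v x - w x).
  by rewrite mulrBr; congr (_ - _); exact: linearZ.
by rewrite normrM normfV normr_id ler_pdivrMl// mulrC.
Qed.

Lemma dual_bounded (R : realType) (X : normedModType R) (v : dual X) :
  exists2 M : R, 0 < M & forall x, `|v x| <= M * `|x|.
Proof.
have /linear_boundedP bv :=
  (linear_bounded_continuous v).2 (@dual_continuous _ _ v).
by have [M M0 vM] := pinfty_ex_gt0 bv; exists M.
Qed.

(** Zorn's lemma is applied to linear relations dominated by the norm. A maximal one is total, by a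
    one-dimensional extension, and domination makes it single-valued, so it is the graph of a
    functional. Keeping [L], the line through [(x0, |x0|)], in the relation fixes the value at
    [x0]. *)
Lemma hahn_banach_norming (R : realType) (X : normedModType R) (x0 : X) :
  exists2 v : dual X, v x0 = `|x0| & forall x, `|v x| <= `|x|.
Proof.
pose lin_graph (g : set (X * R)) := forall c p q, g p -> g q ->
  g (c *: p.1 + q.1, c * p.2 + q.2).
pose dominated (g : set (X * R)) := forall p, g p -> p.2 <= `|p.1|.
pose L : set (X * R) := [set (c *: x0, c * `|x0|) | c in [set: R]].
have L_lin : lin_graph L.
  move=> c _ _ [a _ <-] [b _ <-] /=; exists (c * a + b) => //.
  by rewrite scalerDl scalerA mulrDl mulrA.
have L_dom : dominated L.
  by move=> _ [c _ <-] /=; rewrite normrZ ler_wpM2r// ler_norm.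
(* [Zorn_bigcup] needs [P set0], so [P] cannot require [L] inside [g]. *)
pose P (g : set (X * R)) := lin_graph (g `|` L) /\ dominated (g `|` L).
have [A [[A_lin A_dom] A_max]] : exists A, P A /\ forall B, A `<` B -> ~ P B.
  apply: Zorn_bigcup => F FP Ftot; split; last first.
    move=> p [[g Fg gp]|Lp]; last exact: L_dom.
    by have [_] := FP _ Fg; apply; left.
  move=> c p q [[g Fg gp]|Lp] [[h Fh hq]|Lq].
  - have [gh|hg] := Ftot _ _ Fg Fh.
    + have [h_lin _] := FP _ Fh.
      have [||hpq|] := h_lin c p q; [by left; exact: gh|by left| |by right].
      by left; exists h.
    + have [g_lin _] := FP _ Fg.
      have [||gpq|] := g_lin c p q; [by left|by left; exact: hg| |by right].
      by left; exists g.
  - have [g_lin _] := FP _ Fg.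
    have [||gpq|] := g_lin c p q; [by left|by right| |by right].
    by left; exists g.
  - have [h_lin _] := FP _ Fh.
    have [||hpq|] := h_lin c p q; [by right|by left| |by right].
    by left; exists h.
  - by right; exact: L_lin.
set G := A `|` L in A_lin A_dom.
have G0 : G (0, 0) by right; exists 0 => //; rewrite scale0r mul0r.
have GZ c y b : G (y, b) -> G (c *: y, c * b).
  by move=> Gyb; have := A_lin c _ _ Gyb G0; rewrite /= !addr0.
have G_total y : exists b, G (y, b).
  apply: contrapT => nGy.
  (* A value [a] at [y] must satisfy [q.2 - |q.1 - y| <= a <= |p.1 + y| - p.2] for all [p], [q] in
     [G]. By [S_ub] each left side is at most each right side, so [sup S] fits. *)
  pose S := [set p.2 - `|p.1 - y| | p in G].
  have S_ub p : G p -> ubound S (`|p.1 + y| - p.2).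
    move=> Gp _ [q Gq <-]; have := A_dom _ (A_lin 1 _ _ Gp Gq).
    rewrite /= scale1r mul1r => pq.
    rewrite lerBlDr addrAC lerBrDr [leLHS]addrC (le_trans pq)//.
    have -> : p.1 + q.1 = (p.1 + y) + (q.1 - y) by rewrite addrACA subrr addr0.
    exact: ler_normD.
  pose a := sup S.
  have S_bnd : has_ubound S by exists (`|0 + y| - 0); exact: (S_ub _ G0).
  have le_plus p : G p -> p.2 + a <= `|p.1 + y|.
    move=> Gp; rewrite -lerBrDl; apply: ge_sup; last exact: S_ub.
    by exists (0 - `|0 - y|); exists (0, 0).
  have le_minus p : G p -> p.2 - a <= `|p.1 - y|.
    move=> Gp; rewrite lerBlDr -lerBlDl; apply: ub_le_sup => //.
    by exists p.
  pose G' : set (X * R) :=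
    [set (p.1 + t *: y, p.2 + t * a) | p in G & t in [set: R]].
  have G'_sub : G `<=` G'.
    move=> [z b] Gp; exists (z, b) => //; exists 0 => //=.
    by rewrite scale0r mul0r !addr0.
  have G'U : G' `|` L = G'.
    apply/setUidPl => p Lp; apply: G'_sub; by right.
  apply: (A_max G').
    split; first by move=> p Ap; apply: G'_sub; left.
    move=> sub; apply: nGy; exists a; left; apply: sub.
    by exists (0, 0) => //; exists 1 => //=; rewrite scale1r mul1r !add0r.
  rewrite /P G'U; split.
    move=> c _ _ [p Gp [t _ <-]] [q Gq [s _ <-]] /=.
    exists (c *: p.1 + q.1, c * p.2 + q.2); first exact: A_lin.
    exists (c * t + s) => //=; congr pair; last by ring.
    by rewrite scalerDr scalerDl scalerA addrACA.
  move=> _ [[z b] Gp [t _ <-]] /=.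
  (* By homogeneity, [t > 0] reduces to [le_plus] and [t < 0] to [le_minus], after division by
     [|t|]. *)
  have [t0|t0|->] := ltgtP t 0; last 2 first.
  - have := le_plus _ (GZ t^-1 _ _ Gp); rewrite /= => /(ler_wpM2l (ltW t0)).
    rewrite mulrDr mulrA mulfV ?gt_eqF// mul1r => /le_trans; apply.
    rewrite -{1}(gtr0_norm t0) -normrZ scalerDr scalerA mulfV ?gt_eqF//.
    by rewrite scale1r.
  - by rewrite scale0r mul0r !addr0; exact: (A_dom _ Gp).
  - have s0 : 0 < - t by rewrite oppr_gt0.
    have := le_minus _ (GZ (- t)^-1 _ _ Gp).
    rewrite /= => /(ler_wpM2l (ltW s0)).
    rewrite mulrBr mulrA mulfV ?gt_eqF// mul1r mulNr opprK => /le_trans; apply.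
    rewrite -{1}(gtr0_norm s0) -normrZ scalerBr scalerA mulfV ?gt_eqF//.
    by rewrite scale1r scaleNr opprK.
(* Subtracting two pairs over [y] gives [(0, b - c)], and domination yields [b - c <= 0]. *)
have G_fun y b c : G (y, b) -> G (y, c) -> b = c.
  have le_bc b' c' : G (y, b') -> G (y, c') -> b' <= c'.
    move=> Gb Gc; have := A_dom _ (A_lin (-1) _ _ Gc Gb).
    by rewrite /= scaleN1r mulN1r addNr normr0 addrC subr_le0.
  by move=> Gb Gc; apply/eqP; rewrite eq_le !le_bc.
have [f Gf] := choice G_total.
have f_lin c x y : f (c *: x + y) = c * f x + f y.
  exact: G_fun (Gf _) (A_lin c _ _ (Gf x) (Gf y)).
have f_bnd x : `|f x| <= `|x|.
  rewrite ler_norml (A_dom _ (Gf x)) andbT lerNl -normrN.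
  have := A_dom _ (GZ (-1) _ _ (Gf x)).
  by rewrite /= scaleN1r mulN1r.
have [v vf] := @dual_of_bounded_linear _ _ f 1 f_lin
  (fun x => etrans (congr1 (fun r => `|f x| <= r) (mul1r _)) (f_bnd x)).
exists v => [|x]; rewrite vf//; apply: G_fun (Gf x0) _; right.
by exists 1 => //; rewrite scale1r mul1r.
Qed.

(** * Completeness of the dual and uniform boundedness *)

(** A Cauchy filter converges pointwise, and the Cauchy estimates survive in the pointwise limit
    uniformly on the unit ball. The Cauchy property is spelled out with [dual_dist] because [dual]
    carries no metric structure of its own. *)
Lemma dual_complete (R : realType) (X : normedModType R)
    (G : set_system (dual X)) : ProperFilter G ->
  (forall e : R, 0 < e ->
    exists v : dual X, \forall w \near G, dual_dist v w < e) ->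
  exists v : dual X, forall e : R, 0 < e ->
    \forall w \near G, dual_dist v w < e.
Proof.
move=> PG G_cauchy.
have pointwise x : exists l : R, (fun w : dual X => w x : R) @ G --> l.
  suff : cvg ((fun w : dual X => w x : R) @ G) by move=> /cvg_ex.
  apply/cauchy_cvgP/cauchy_exP => e e0.
  (* The added 1 keeps the divisor positive at [x = 0]. *)
  have nx0 : 0 < `|x| + 1 by rewrite ltr_wpDl.
  have [v vG] := G_cauchy _ (divr_gt0 e0 nx0).
  exists (v x : R); apply: filterS vG => w vw.
  rewrite -ball_normE /ball_ /=; apply: le_lt_trans (dual_dist_bound v w x) _.
  rewrite -(divfK (lt0r_neq0 nx0) e) mulrC.
  rewrite (@le_lt_trans _ _ ((`|x| + 1) * dual_dist v w))//.
    by rewrite ler_wpM2r ?dual_dist_ge0// lerDl.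
  by rewrite [ltRHS]mulrC ltr_pM2l.
have [f fG] := choice pointwise.
have f_lin c x y : f (c *: x + y) = c * f x + f y.
  apply: (cvg_unique (@Rhausdorff R) (fG _)).
  have -> : (fun w : dual X => w (c *: x + y) : R) =
            (fun w => c * w x + w y).
    by apply/funext => w; rewrite linearP.
  by apply: cvgD; [apply: cvgMr; exact: fG|exact: fG].
have f_near (v : dual X) e : (\forall w \near G, dual_dist v w <= e) ->
    forall x, `|f x - v x| <= e * `|x|.
  move=> vG x; rewrite distrC.
  have cv : (fun w : dual X => `|v x - w x| : R) @ G --> `|v x - f x|.
    by apply: cvg_norm; apply: cvgB; [exact: cvg_cst|exact: fG].
  apply: (cvgr_to_le cv); apply: filterS vG => w vw.
  apply: le_trans (dual_dist_bound v w x) _.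
  by rewrite ler_wpM2r.
have [v0 v0G] := G_cauchy 1 ltr01.
have [M M0 v0M] := dual_bounded v0.
have f_bnd x : `|f x| <= (1 + M) * `|x|.
  have -> : f x = (f x - v0 x) + v0 x by rewrite subrK.
  rewrite (le_trans (ler_normD _ _))// mulrDl lerD//.
  by apply: f_near; apply: filterS v0G => w; exact: ltW.
have [v vf] := dual_of_bounded_linear f_lin f_bnd.
exists v => e e0; have e2 : 0 < e / 2 by rewrite divr_gt0.
have [u uG] := G_cauchy _ e2.
have vu : dual_dist v u <= e / 2.
  apply: dual_dist_le => x x1; rewrite vf.
  rewrite (le_trans (f_near u (e / 2) _ x))//.
    by apply: filterS uG => w; exact: ltW.
  by rewrite ler_piMr// ltW.
apply: filterS uG => w uw; apply: le_lt_trans (dual_dist_triangle u v w) _.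
by rewrite (splitr e) ler_ltD.
Qed.

(* Sokal's gliding hump: the increments [v n.+1 - v n] shrink geometrically, so
   their sum cannot destroy the large value acquired at [x n]. *)
Lemma weakly_bounded_bounded (R : realType) (X : normedModType R) (A : set X) :
  (forall v : dual X, exists M : R, forall x, A x -> `|v x| <= M) ->
  exists2 M : R, 0 < M & forall x, A x -> `|x| <= M.
Proof.
move=> A_weak; apply: contrapT => A_unbounded.
(* With this growth, a step of size [3 ^- n] in the dual can still produce a value of at least [n]
   at [x n]. *)
have large n : exists x, A x /\ n%:R * 3 ^+ n <= `|x|.
  apply: contrapT => nx; apply: A_unbounded.
  exists (n%:R * 3 ^+ n + 1) => [|x Ax].
    by rewrite ltr_wpDl// mulr_ge0// exprn_ge0.
  rewrite leNgt; apply/negP => xM; apply: nx; exists x; split => //.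
  by rewrite (le_trans _ (ltW xM))// lerDl.
have [x x_large] := choice large.
have hump (nw : nat * dual X) : exists w' : dual X,
    dual_dist nw.2 w' <= 3 ^- nw.1 /\ 3 ^- nw.1 * `|x nw.1| <= `|w' (x nw.1)|.
  case: nw => n w /=; set r : R := 3 ^- n; set y := x n.
  have r0 : 0 < r by rewrite invr_gt0 exprn_gt0.
  have [u uy u1] := hahn_banach_norming y.
  have [K K0 wK] := dual_bounded w.
  (* The candidates are [w + r u] and [w - r u], with [u] norming [y]. Their values at [y] differ by
     [2 r |y|], so one of them has absolute value at least [r |y|]. *)
  have shift (s : R) : `|s| = r -> exists2 w' : dual X,
      forall z, w' z = w z + s * u z & dual_dist w w' <= r.
    move=> sr.
    have lin c a b : w (c *: a + b) + s * u (c *: a + b) =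
        c * (w a + s * u a) + (w b + s * u b) :> R.
      by rewrite !linearP/=; rewrite /GRing.scale/=; ring.
    have bnd z : `|w z + s * u z| <= (K + r) * `|z|.
      rewrite (le_trans (ler_normD _ _))// mulrDl lerD// normrM sr.
      by rewrite ler_wpM2l// ltW.
    have [w' w'E] := dual_of_bounded_linear lin bnd.
    exists w' => //; apply: dual_dist_le => z z1.
    rewrite w'E opprD addrA subrr sub0r normrN normrM sr.
    by rewrite ler_piMr ?(ltW r0)// (le_trans (u1 z)).
  have [wp wpE dp] := shift r (gtr0_norm r0).
  have [wm wmE dm] := shift (- r) (etrans (normrN r) (gtr0_norm r0)).
  have [le_p|lt_p] := leP (r * `|y|) `|wp y|; first by exists wp.
  exists wm; split => //; rewrite leNgt; apply/negP => lt_m.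
  move: lt_p lt_m; rewrite wpE wmE uy.
  rewrite !ltr_norml => /andP[_ h1] /andP[h2 _]; lra.
have [h hP] := choice hump.
(* Any element of the dual can start the recursion. *)
have [v0 _ _] := hahn_banach_norming (0 : X).
pose v := fix v n := if n is m.+1 then h (m, v m) else v0.
have v_step n : dual_dist (v n) (v n.+1) <= 3 ^- n.
  by have [] := hP (n, v n).
have v_large n : 3 ^- n * `|x n| <= `|v n.+1 (x n)|.
  by have [] := hP (n, v n).
(* The right side is the exact value of the geometric sum of the steps from [n] to [n + k - 1]. *)
have v_dist n k : dual_dist (v n) (v (n + k)%N) <=
    3 / 2 * (3 ^- n - 3 ^- (n + k)).
  elim: k => [|k IH]; first by rewrite addn0 dual_distxx subrr mulr0.
  rewrite addnS; apply: le_trans (dual_dist_triangle (v (n + k)%N) _ _) _.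
  apply: le_trans (lerD IH (v_step _)) _.
  rewrite exprS invfM; lra.
have v_tail n k : dual_dist (v n) (v (n + k)%N) <= 3 / 2 * 3 ^- n.
  apply: le_trans (v_dist n k) _.
  by rewrite ler_wpM2l// lerBlDr lerDl invr_ge0 exprn_ge0.
have pow0 (e : R) : 0 < e -> exists n, 3 / 2 * 3 ^- n < e.
  move=> e0; have q0 : 0 < 2 * e / 3 by rewrite !(mulr_gt0, divr_gt0).
  have q1 : `|3^-1 : R| < 1 by rewrite gtr0_norm ?invr_gt0// invf_lt1// ltr1n.
  have /cvgrPdist_lt /(_ _ q0) [n _ /(_ n (leqnn n))] := cvg_expr q1.
  rewrite sub0r normrN gtr0_norm ?exprn_gt0 ?invr_gt0//= exprVn => lt_n.
  by exists n; lra.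
have [w vw] : exists w : dual X, forall e : R, 0 < e ->
    \forall n \near \oo, dual_dist w (v n) < e.
  apply: (dual_complete (G := v @ \oo)) => e e0.
  have [n ne] := pow0 _ e0; exists (v n); exists n => // m /= nm.
  by rewrite -(subnKC nm); apply: le_lt_trans (v_tail _ _) ne.
have w_near n : dual_dist w (v n) <= 3 / 2 * 3 ^- n.
  apply/ler_addgt0Pl => e e0; have [N _ Nw] := vw _ e0.
  apply: le_trans (dual_dist_triangle (v (n + N)%N) _ _) _.
  by rewrite lerD ?(ltW (Nw _ (leq_addl _ _)))// dual_dist_sym v_tail.
(* The steps after [v n.+1] move the functional by at most [3 / 2 * 3 ^- n.+1 = 3 ^- n / 2], so at
   least half of the value acquired at [x n] remains. The ratio 3 makes this loss strictly smaller
   than the gain. *)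
have w_large n : n%:R / 2 <= `|w (x n)| :> R.
  set p : R := 3 ^- n.
  have p0 : 0 < p by rewrite invr_gt0 exprn_gt0.
  have : `|v n.+1 (x n)| <= `|w (x n)| + p / 2 * `|x n|.
    have -> : v n.+1 (x n) = w (x n) - (w (x n) - v n.+1 (x n)) :> R.
      by rewrite opprB addrC subrK.
    rewrite (le_trans (ler_normB _ _))// lerD2l.
    rewrite (le_trans (dual_dist_bound _ _ _))// ler_wpM2r//.
    rewrite (le_trans (w_near _))// exprS invfM -/p; lra.
  have := v_large n; rewrite -/p => h1 h2.
  have : n%:R <= p * `|x n|.
    rewrite -ler_pdivrMl// /p invrK mulrC; exact: (x_large n).2.
  lra.
have [M wM] := A_weak w.
pose n := (Num.Def.truncn (2 * `|M|)).+1.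
have := truncnS_gt (2 * `|M|); rewrite -/n => nM.
have := le_trans (w_large n) (wM _ (x_large n).1).
have := ler_norm M; lra.
Qed.

(** * Locally Lipschitz functions on metric spaces *)

Lemma locally_lipschitzP (R : realType) (S : metricType R) (f : S -> R) :
  locally_lipschitz f <-> forall x, exists r K : R, [/\ 0 < r, 0 < K &
    forall y z, mdist x y < r -> mdist x z < r ->
      `|f y - f z| <= K * mdist y z].
Proof.
split=> [f_lip x|f_lip x].
  have [U /metricType_numDomainType.nbhs_mdistP[r r0 rU] [K K0 fK]] := f_lip x.
  by exists r, K; split => // y z xy xz; apply: fK; apply: rU.
have [r [K [r0 K0 fK]]] := f_lip x.
exists [set y | mdist x y < r].
  by apply/metricType_numDomainType.nbhs_mdistP; exists r.
by exists K => // y z; exact: fK.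
Qed.

Lemma locally_lipschitzB (R : realType) (S : metricType R) (f g : S -> R) :
  locally_lipschitz f -> locally_lipschitz g ->
  locally_lipschitz (fun x => f x - g x).
Proof.
move=> /locally_lipschitzP f_lip /locally_lipschitzP g_lip.
apply/locally_lipschitzP => x.
have [r [K [r0 K0 fK]]] := f_lip x; have [s [L [s0 L0 gL]]] := g_lip x.
exists (Num.min r s), (K + L); split; [by rewrite lt_min r0|exact: addr_gt0|].
move=> y z; rewrite !lt_min => /andP[yr ys] /andP[zr zs].
have -> : f y - g y - (f z - g z) = (f y - f z) - (g y - g z) by ring.
by rewrite (le_trans (ler_normB _ _))// mulrDl lerD ?fK ?gL.
Qed.

Lemma locally_lipschitz_subspace (R : realType) (S : metricType R) (A : set S)
    (f : S -> R) :
  locally_lipschitz f -> locally_lipschitz (fun x : A => f (\val x)).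
Proof.
move=> /locally_lipschitzP f_lip; apply/locally_lipschitzP => x.
have [r [K [r0 K0 fK]]] := f_lip (\val x).
by exists r, K; split => // y z; exact: fK.
Qed.

(** The splitting [v x - w y = (v - w) x + w (x - y)] reduces the claim to bounds on [|x|] and on
    the norm of [w] near the base point. *)
Lemma locally_lipschitz_pairing (R : realType) (X : normedModType R)
    (D : set X) :
  locally_lipschitz (fun p : dual_pair D => p.1 (\val p.2) : R).
Proof.
apply/locally_lipschitzP => -[v0 x0].
have [M M0 v0M] := dual_bounded v0.
(* On the unit ball around [(v0, x0)], [|x|] is at most [|x0| + 1] and the norm of [w] at most
   [M + 1]; the constant is their sum. *)
exists 1, (`|\val x0| + 1 + (M + 1)); split => //.
  by rewrite addr_gt0// ?addr_gt0// ltr_wpDl.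
move=> [v x] [w y].
rewrite /mdist/= /dual_pair_dist/= => vx wy.
have x_bnd : `|\val x| <= `|\val x0| + 1.
  have -> : \val x = \val x0 - (\val x0 - \val x) by rewrite opprB addrC subrK.
  rewrite (le_trans (ler_normB _ _))// lerD2l ltW//.
  by apply: le_lt_trans vx; rewrite lerDr dual_dist_ge0.
have w_bnd (z : X) : `|w z| <= (M + 1) * `|z|.
  have -> : w z = v0 z - (v0 z - w z) :> R by rewrite opprB addrC subrK.
  rewrite (le_trans (ler_normB _ _))// mulrDl lerD//.
  rewrite (le_trans (dual_dist_bound _ _ _))// ler_wpM2r// ltW//.
  by apply: le_lt_trans wy; rewrite lerDl.
have -> : v (\val x) - w (\val y) =
    (v (\val x) - w (\val x)) + w (\val x - \val y) :> R.
  by rewrite linearB/=; ring.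
rewrite (le_trans (ler_normD _ _))//.
have h1 := dual_dist_bound v w (\val x).
have h2 := w_bnd (\val x - \val y).
have h3 := ler_wpM2l (dual_dist_ge0 v w) x_bnd.
have := normr_ge0 (\val x0); have := normr_ge0 (\val x - \val y).
have := dual_dist_ge0 v w; nra.
Qed.

(** * Coercivity, regularity of the energy, and consequences for [F] *)

Section energy.
Context {R : realType} {X : normedModType R} {D : set X} {F : X -> R}.
Context (D_nonempty : D !=set0)
  (E_finite : forall v : dual X, (-oo < energy D F v)%E).

Local Notation E v := (fine (energy D F v)).

Lemma energy_fin_num v : energy D F v \is a fin_num.
Proof.
rewrite fin_numE gt_eqF//= lt_eqF//; have [x Dx] := D_nonempty.
apply: (@le_lt_trans _ _ (F x + v x)%:E); last by rewrite ltry.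
by apply: ereal_inf_lbound; exists x.
Qed.

Lemma energy_le (v : dual X) x : D x -> E v <= F x + v x.
Proof.
move=> Dx; rewrite -lee_fin fineK ?energy_fin_num//.
by apply: ereal_inf_lbound; exists x.
Qed.

Lemma energy_adherent (v : dual X) (e : R) : 0 < e ->
  exists2 x, D x & F x + v x < E v + e.
Proof.
move=> e0; have [_ [x Dx <-]] := lb_ereal_inf_adherent e0 (energy_fin_num v).
move=> lt_x; exists x => //.
by rewrite -lte_fin (EFinD (fine _)) fineK ?energy_fin_num.
Qed.

(** Finiteness of [E (v + w)] bounds [- w x] above by [F x + v x] plus a constant. Used for [w] and
    [- w], this makes the vectors [x / s x] weakly bounded, hence norm bounded. *)
Lemma energy_coercive (v : dual X) : exists2 K : R, 0 < K &
  forall x, D x -> `|x| <= K * (F x + v x - E v + 1).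
Proof.
pose s x : R := F x + v x - E v + 1.
have s_ge1 x : D x -> 1 <= s x.
  by move=> Dx; rewrite lerDr subr_ge0 energy_le.
have [|K K0 DK] := @weakly_bounded_bounded R X [set (s x)^-1 *: x | x in D].
  have below (w : dual X) : exists2 M, 0 <= M &
      forall x, D x -> - w x <= M * s x.
    have [a a0 va] := dual_bounded v; have [b b0 wb] := dual_bounded w.
    have lin c x y : v (c *: x + y) + w (c *: x + y) =
        c * (v x + w x) + (v y + w y) :> R.
      by rewrite !linearP/=; rewrite /GRing.scale/=; ring.
    have bnd x : `|v x + w x| <= (a + b) * `|x|.
      by rewrite (le_trans (ler_normD _ _))// mulrDl lerD.
    have [u uE] := dual_of_bounded_linear lin bnd.
    (* With [u = v + w], [- w x <= s x - 1 + E v - E u]; since [s x >= 1], the constant is absorbed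
       into a multiple of [s x]. *)
    exists (1 + `|E v - E u|) => [|x Dx]; first by rewrite addr_ge0.
    have := energy_le u Dx; rewrite uE.
    have := s_ge1 _ Dx; have := ler_norm (E v - E u).
    have : 0 <= `|E v - E u| * (s x - 1) by rewrite mulr_ge0// subr_ge0 s_ge1.
    rewrite /s; lra.
  move=> w; have [M M0 wM] := below w.
  have [w' w'E] : exists w' : dual X, forall x, w' x = - w x.
    have [b b0 wb] := dual_bounded w.
    apply: (@dual_of_bounded_linear _ _ _ b) => [c x y|x].
      by rewrite linearP/= /GRing.scale/=; ring.
    by rewrite normrN.
  have [N N0 w'N] := below w'.
  exists (M + N) => _ [x Dx <-].
  have s0 : 0 < s x by apply: lt_le_trans (s_ge1 _ Dx).
  have -> : w ((s x)^-1 *: x) = (s x)^-1 * w x :> R by exact: linearZ.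
  rewrite normrM gtr0_norm ?invr_gt0// ler_pdivrMl//.
  have := wM _ Dx; have := w'N _ Dx; rewrite w'E.
  have := mulr_ge0 M0 (ltW s0); have := mulr_ge0 N0 (ltW s0).
  by rewrite ler_norml; move=> *; apply/andP; split; lra.
exists K => // x Dx.
have s0 : 0 < s x by apply: lt_le_trans (s_ge1 _ Dx).
have := DK _ (imageP _ Dx).
by rewrite normrZ gtr0_norm ?invr_gt0// ler_pdivrMl// mulrC.
Qed.

(** Coercivity at [v0] alone suffices: replacing [v] by [v0] costs [r |x|], which a small [r]
    absorbs into the coercive term. *)
Lemma almost_minimizers_bounded (v0 : dual X) (A : R) :
  exists r L : R, [/\ 0 < r, 0 < L &
    forall (v : dual X) x, dual_dist v0 v < r -> D x ->
      F x + v x <= E v + A -> `|x| <= L].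
Proof.
have [K K0 DK] := energy_coercive v0; have [x0 Dx0] := D_nonempty.
pose r := (2 * K)^-1.
have r0 : 0 < r by rewrite invr_gt0 mulr_gt0.
(* Write [s = F x + v0 x - E v0 + 1]. Testing [E v] at [x0] gives [s <= M + r |x|], and
   [r |x| <= r K s = s / 2], whence [s <= 2 M]. *)
pose M : R := F x0 + v0 x0 + r * `|x0| + A + 1 - E v0.
exists r, (1 + `|K * (2 * M)|); split => //.
move=> v x vr Dx vA.
have rK : r * K = 2^-1 by rewrite /r invfM mulfVK// gt_eqF.
have dist_r (z : X) : `|v0 z - v z| <= r * `|z|.
  rewrite (le_trans (dual_dist_bound _ _ _))// ler_wpM2r//; exact: ltW.
have /andP[h1 _] : - (r * `|x0|) <= v0 x0 - v x0 <= r * `|x0|.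
  by rewrite -ler_norml.
have /andP[_ h2] : - (r * `|x|) <= v0 x - v x <= r * `|x|.
  by rewrite -ler_norml.
have h3 := energy_le v Dx0.
have h4 := DK _ Dx.
have h5 := ler_wpM2l (ltW r0) h4; rewrite mulrA rK in h5.
have sM : F x + v0 x - E v0 + 1 <= 2 * M by rewrite /M; lra.
rewrite (le_trans h4)// (le_trans (ler_wpM2l (ltW K0) sM))//.
by rewrite (le_trans (ler_norm _))// lerDr.
Qed.

(** An almost minimizer [x] for [u] is a competitor for [u'], so [E u' - E u] exceeds [(u' - u) x]
    by an arbitrarily small amount at most, and [|x| <= L]. *)
Lemma energy_lipschitz (v0 : dual X) : exists r L : R, [/\ 0 < r, 0 < L &
  forall v w, dual_dist v0 v < r -> dual_dist v0 w < r ->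
    `|E v - E w| <= L * dual_dist v w].
Proof.
have [r [L [r0 L0 bnd]]] := almost_minimizers_bounded v0 1.
exists r, L; split => // v w vr wr.
have half u u' : dual_dist v0 u < r -> E u' - E u <= L * dual_dist u u'.
  move=> ur; apply/ler_addgt0Pl => e e0.
  (* The cap at 1 keeps [x] among the almost minimizers bounded by [L]. *)
  have e1 : 0 < Num.min e 1 by rewrite lt_min e0 ltr01.
  have [x Dx lt_x] := energy_adherent u e1.
  have [le_e le_1] : Num.min e 1 <= e /\ Num.min e 1 <= 1.
    by rewrite !ge_min !lexx orbT.
  have xL : `|x| <= L by apply: (bnd u) => //; lra.
  have h1 := energy_le u' Dx.
  have h2 := dual_dist_bound u u' x.
  have h3 := ler_wpM2l (dual_dist_ge0 u u') xL.
  have := ler_norm (- (u x - u' x)); rewrite normrN; lra.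
rewrite ler_norml; have := half v w vr; have := half w v wr.
by rewrite dual_dist_sym => *; apply/andP; split; lra.
Qed.

Lemma energy_locally_lipschitz : locally_lipschitz (E_fun F : dual_pair D -> R).
Proof.
apply/locally_lipschitzP => p; have [r [L [r0 L0 EL]]] := energy_lipschitz p.1.
exists r, L; split => // q q'; rewrite /mdist/= /dual_pair_dist => qr q'r.
have le1 (u u' : dual_pair D) :
    dual_dist u.1 u'.1 <= dual_dist u.1 u'.1 + `|\val u.2 - \val u'.2|.
  by rewrite lerDl.
apply: le_trans (EL _ _ _ _) _; [exact: le_lt_trans qr|exact: le_lt_trans q'r|].
by rewrite ler_wpM2l// ltW.
Qed.

Lemma locally_lipschitz_energyB : locally_lipschitz
  (fun p : dual_pair D => E p.1 - p.1 (\val p.2)).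
Proof.
exact: (locally_lipschitzB energy_locally_lipschitz
                           (@locally_lipschitz_pairing R X D)).
Qed.

Lemma Delta_ge0 (p : dual_pair D) : 0 <= Delta F p.
Proof. by rewrite subr_ge0; apply: energy_le; exact: set_mem (valP p.2). Qed.

Lemma F_locally_lipschitz_minimizers : locally_lipschitz
  (fun p : [set p : dual_pair D | Delta F p = 0] => F_fun F (\val p)).
Proof.
have := locally_lipschitz_subspace (A := [set p | Delta F p = 0])
  locally_lipschitz_energyB.
congr locally_lipschitz; apply/funext => p.
have : Delta F (\val p) = 0 by exact: set_mem (valP p).
by move/eqP; rewrite /Delta /F_fun subr_eq0 => /eqP <-; rewrite addrK.
Qed.

(** On the sublevel both values of [Delta] lie in [[0, eps]] and so differ by at most [eps]; the
    remaining part [H] of [F] varies by less than [eps']. *)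
Lemma F_almost_continuous :
  almost_continuous_wrt (Delta F : dual_pair D -> R) (F_fun F).
Proof.
move=> eps eps0 p eps' eps'0.
have /locally_lipschitzP/(_ p)[r [K [r0 K0 HK]]] := locally_lipschitz_subspace
  (A := [set p | Delta F p <= eps]) locally_lipschitz_energyB.
exists (Num.min r (eps' / K)) => [|q]; first by rewrite lt_min r0 divr_gt0.
rewrite metric_sym lt_min => /andP[qr qK].
pose H (u : dual_pair D) : R := E u.1 - u.1 (\val u.2).
have FE u : F_fun F u = Delta F u + H u.
  by rewrite /Delta /F_fun /H addrA subrK addrK.
have : `|H (\val p) - H (\val q)| < eps'.
  apply: le_lt_trans (HK p q _ qr) _; first by rewrite mdistxx.
  by move: qK; rewrite ltr_pdivlMr// mulrC.
have : Delta F (\val p) <= eps by exact: set_mem (valP p).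
have : Delta F (\val q) <= eps by exact: set_mem (valP q).
have := Delta_ge0 (\val p); have := Delta_ge0 (\val q); rewrite !FE.
move: (Delta F _) (Delta F _) (H (\val p)) (H (\val q)) => a b c d.
rewrite !ltr_norml => h1 h2 h3 h4 /andP[h5 h6].
by apply/andP; split; lra.
Qed.

End energy.

(** * Completeness of the sublevels of [Delta] *)

(** On the sublevel [F <= eps + H], and [H] is eventually bounded above along a Cauchy filter. Lower
    semicontinuity enters twice: to exclude the value [+oo] at the limit, then to pass the
    inequality to the limit. *)
Lemma complete_energy_sublevel (R : realType) (X : normedModType R) (D : set X)
    (F : X -> R) (Y : completeNormedModType R) (i : {linear X -> Y})
    (D_nonempty : D !=set0) (i_isometry : forall x, `|i x| = `|x|)
    (F_lsc : lower_semicontinuous (extend_pinfty i D F))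
    (E_finite : forall v : dual X, (-oo < energy D F v)%E) (eps : R) :
  complete_space [set p : dual_pair D | Delta F p <= eps].
Proof.
move=> G PG /cauchyP G_cauchy.
set T : set (dual_pair D) := [set p | Delta F p <= eps] in G PG G_cauchy *.
pose vec (p : T) : dual X := (\val p).1.
pose pt (p : T) : X := \val (\val p).2.
have D_pt p : D (pt p) by exact: set_mem (valP (\val p).2).
have near_pair (e : R) : 0 < e -> exists p : T, \forall q \near G,
    dual_dist (vec p) (vec q) < e /\ `|pt p - pt q| < e.
  move=> e0; have [p Gp] := G_cauchy _ e0; exists p.
  apply: filterS Gp => q; rewrite ballEmdist /=.
  rewrite {1}/mdist/= /mdist/= /dual_pair_dist => pq.
  split; apply: le_lt_trans pq; first by rewrite lerDl.
  by rewrite lerDr dual_dist_ge0.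
have [v Gv] : exists v : dual X, forall e : R, 0 < e ->
    \forall p \near G, dual_dist v (vec p) < e.
  apply: (dual_complete (G := vec @ G)) => e e0.
  have [p Gp] := near_pair _ e0; exists (vec p).
  by apply: filterS Gp => q [].
have [y Gy] : exists y : Y, (fun p => i (pt p)) @ G --> y.
  suff : cvg ((fun p => i (pt p)) @ G) by move=> /cvg_ex.
  apply/cauchy_cvgP/cauchy_exP => e e0.
  have [p Gp] := near_pair _ e0; exists (i (pt p)).
  apply: filterS Gp => q [_]; rewrite -ball_normE /ball_ /=.
  by rewrite -linearB i_isometry.
have Gy_lt (e : R) : 0 < e -> \forall p \near G, `|y - i (pt p)| < e.
  by move/cvgrPdist_lt : Gy; exact.
have i_inj : injective i.
  move=> x x' /eqP; rewrite -subr_eq0 -linearB -normr_eq0 i_isometry normr_eq0.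
  by rewrite subr_eq0 => /eqP.
have F_bnd p : F (pt p) <= eps - vec p (pt p) + fine (energy D F (vec p)).
  by have : Delta F (\val p) <= eps := set_mem (valP p); rewrite /Delta; lra.
have F_near a : (a%:E < extend_pinfty i D F y)%E ->
    \forall p \near G, a < F (pt p).
  move=> /F_lsc[V Vy aV]; have : \forall p \near G, V (i (pt p)) by exact: Gy.
  by apply: filterS => p /aV; rewrite (extend_pinfty_in _ i_inj).
have [x Dx ixy] : (i @` D) y.
  apply: contrapT => nDy.
  have [r [L [r0 L0 E_lip]]] := energy_lipschitz D_nonempty E_finite v.
  have [K K0 vK] := dual_bounded v.
  set B : R := eps + (K + r) * (`|y| + 1) + (fine (energy D F v) + L * r).
  have /F_near : (B%:E < extend_pinfty i D F y)%E.
    by rewrite extend_pinfty_notin// ltry.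
  move=> GB; have [p [[Bp yp] vp]] :=
    @filter_ex _ G _ _ (filterI (filterI GB (Gy_lt 1 ltr01)) (Gv r r0)).
  have pt_bnd : `|pt p| <= `|y| + 1.
    rewrite -i_isometry; have -> : i (pt p) = y - (y - i (pt p)).
      by rewrite opprB addrC subrK.
    by rewrite (le_trans (ler_normB _ _))// lerD2l ltW.
  have h1 := E_lip v (vec p); rewrite dual_distxx in h1.
  have /andP[h2 _] := etrans (esym (ler_norml _ _)) (h1 r0 vp).
  have h3 := ler_wpM2l (ltW L0) (ltW vp).
  have /andP[_ h4] := etrans (esym (ler_norml _ _))
    (dual_dist_bound v (vec p) (pt p)).
  have /andP[h5 _] := etrans (esym (ler_norml _ _)) (vK (pt p)).
  have h6 := ler_wpM2r (normr_ge0 (pt p)) (ltW vp).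
  have h7 := ler_wpM2l (ltW (addr_gt0 K0 r0)) pt_bnd.
  have := F_bnd p; rewrite /B in Bp; lra.
pose p0 : dual_pair D := (v, SigSub (mem_set Dx)).
have Gp0 (e : R) : 0 < e -> \forall p \near G, mdist p0 (\val p) < e.
  move=> e0; have e2 : 0 < e / 2 by rewrite divr_gt0.
  apply: filterS (filterI (Gv _ e2) (Gy_lt _ e2)) => p [vp yp].
  rewrite /mdist/= /dual_pair_dist/= (splitr e) ltrD//.
  by move: yp; rewrite -ixy -linearB i_isometry.
(* An error [e] is allowed: half is spent on lower semicontinuity of [F] at [x], half on the local
   Lipschitz bound for [H] at [p0]. *)
have Tp0 : T p0.
  apply/ler_addgt0Pl => e e0; rewrite /Delta /=.
  have /locally_lipschitzP/(_ p0)[r [K [r0 K0 H_lip]]] :=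
    locally_lipschitz_energyB D_nonempty E_finite.
  have e2 : 0 < e / 2 by rewrite divr_gt0.
  have rK : 0 < Num.min r (e / 2 / K) by rewrite lt_min r0 !divr_gt0.
  have GF : \forall p \near G, F x - e / 2 < F (pt p).
    apply: F_near; rewrite -ixy (extend_pinfty_in _ i_inj)//.
    by rewrite lte_fin ltrBlDr ltrDl.
  have [p [Fp]] := @filter_ex _ G _ _ (filterI GF (Gp0 _ rK)).
  rewrite lt_min ltr_pdivlMr// => /andP[pr]; rewrite mulrC => pK.
  have := H_lip p0 (\val p); rewrite mdistxx => /(_ r0 pr) /= h.
  have /andP[h1 _] := etrans (esym (ler_norml _ _)) (le_trans h (ltW pK)).
  have := F_bnd p; rewrite /vec /pt /= in Fp h1 *; lra.
exists (SigSub (mem_set Tp0) : T).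
by apply/metricType_numDomainType.fcvgrPdist_lt => e /Gp0.
Qed.

Theorem propositionX1 (R : realType) (X : normedModType R) (D : set X)
    (F : X -> R) (Y : completeNormedModType R) (i : {linear X -> Y})
    (D_nonempty : D !=set0)
    (D_convex : convex_set D)
    (D_span : linear_span D = [set: X])
    (F_convex : convex_function D F)
    (F_bounded_below : has_lbound (F @` D))
    (Y_completion : is_completion i)
    (F_lsc : lower_semicontinuous (extend_pinfty i D F))
    (E_finite : forall v : dual X, (-oo < energy D F v)%E) :
  [/\ (forall eps : R, complete_space [set p : dual_pair D | Delta F p <= eps]),
      locally_lipschitz (E_fun F : dual_pair D -> R),
      locally_lipschitz
        (fun p : [set p : dual_pair D | Delta F p = 0] => F_fun F (\val p)) &
      almost_continuous_wrt (Delta F : dual_pair D -> R) (F_fun F)].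
Proof.
split.
- case: Y_completion => i_isometry _ eps.
  exact: complete_energy_sublevel F_lsc _ _.
- exact: energy_locally_lipschitz.
- exact: F_locally_lipschitz_minimizers.
- exact: F_almost_continuous.
Qed.
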